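(* Let $\mathcal{G} = (\mathcal{V},\mathcal{E})$ be a simple directed graph and let $\mathcal{C} \subseteq \mathcal{V}$. Then $\mathcal{G}$ is identifiable from $\mathcal{C}$ if and only if for all $i \in \mathcal{V}$ we have $\mathcal{N}^+_i \subseteq \mathcal{D}(\mathcal{C})$, where, for each $i$, $\mathcal{D}(\mathcal{C})$ is any derived vertex set of $\mathcal{C}$ with respect to $\mathcal{N}^+_i$ (obtained from $\mathcal{G}$ and $\mathcal{C}$ by the graph simplification process).
   Context: Graphs: $\mathcal{G}=(\mathcal{V},\mathcal{E})$ is a finite directed graph with vertex set $\mathcal{V}=\{1,\dots,n\}$ and edge set $\mathcal{E}\subseteq\mathcal{V}\times\mathcal{V}$; it is simple, i.e. without self-loops and with at most one edge from one node to another. For an edge $(i,j)$, which is an outgoing edge of $i$, $j$ is an out-neighbour of $i$ and $i$ is an in-neighbour of $j$. $\mathcal{N}_i^+$ and $\mathcal{N}_i^-$ are the sets of out-neighbours and in-neighbours of $i$. A path is a set of edges $\{(v_i,v_{i+1}) : i=1,\dots,k\}\subseteq\mathcal{E}$ with $v_1,\dots,v_{k+1}$ distinct; it has starting node $v_1$ and end node $v_{k+1}$. A node $j$ is reachable from $\mathcal{U}\subseteq\mathcal{V}$ if $j\in\mathcal{U}$ (by convention) or there is a path from some node of $\mathcal{U}$ to $j$. Admissible network matrices: $\mathcal{A}(\mathcal{G})$ is the set of all $n\times n$ matrices $G(z)$ such that (P1) every entry $G_{ij}(z)$ is a proper rational function of $z$ with real coefficients (degree of numerator at most degree of denominator); (P2)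 $G_{ij}(z)$ is nonzero if and only if $(j,i)\in\mathcal{E}$; (P3) every principal minor of $\lim_{z\to\infty}(I-G(z))$ is nonzero. For $G\in\mathcal{A}(\mathcal{G})$, $T(z;G):=(I-G(z))^{-1}$. Identifiability: for $\mathcal{C}=\{v_1,\dots,v_p\}\subseteq\mathcal{V}$ let $C$ be the $p\times n$ matrix with $C_{ij}=1$ if $j=v_i$ and $C_{ij}=0$ otherwise. The graph $\mathcal{G}$ is (globally) identifiable from $\mathcal{C}$ if for all $G(z),\bar G(z)\in\mathcal{A}(\mathcal{G})$: $C\,T(z;G)=C\,T(z;\bar G)$ implies $G(z)=\bar G(z)$. Graph simplification process (for given $\mathcal{G}$ and $\mathcal{U},\mathcal{W}\subseteq\mathcal{V}$): consider the following two operations on the current graph and the current set $\mathcal{W}$. (1) Remove all outgoing edges of nodes in $\mathcal{W}$ from the graph. (2) If some $k\in\mathcal{W}\setminus\mathcal{U}$ has exactly one in-neighbour $j\in\mathcal{N}_k^-$ that is reachable from $\mathcal{U}$ (in-neighbours and reachability taken in the current graph), replace $k$ by $j$ in $\mathcal{W}$, i.e. replace $\mathcal{W}$ by $(\mathcal{W}\setminus\{k\})\cup\{j\}$. Operations 1 and 2 are applied consecutively, in any order, until no more changes are possible. Any final vertex set obtained this way is called a derived vertex set of $\mathcal{W}$ with respect to $\mathcal{U}$ and denoted $\mathcal{D}(\mathcal{W})$; it need not be unique. Here it is used with $\mathcal{W}=\mathcal{C}$ and, separately for each $i\in\mathcal{V}$, with $\mathcal{U}=\mathcal{N}_i^+$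 (taken in the original graph $\mathcal{G}$), each time starting from the original $\mathcal{G}$ and $\mathcal{C}$. *)

(* Defs.v *)
From HB Require Import structures.
From Stdlib Require Import Relation_Operators.
From mathcomp Require Import all_boot all_order all_algebra.
From mathcomp Require Import all_classical all_reals all_analysis.

Set Implicit Arguments.
Unset Strict Implicit.
Unset Printing Implicit Defensive.

Import Order.TTheory GRing.Theory Num.Theory.
Import numFieldNormedType.Exports.

Local Open Scope quotient_scope.
Local Open Scope ring_scope.

Section Digraph.
Variable n : nat.
Implicit Types (E : {set 'I_n * 'I_n}) (U W : {set 'I_n}).

(* A digraph on 'I_n is its edge set, so multiple edges are excluded by
   construction. *)
Definition simple_digraph E : Prop := forall i, (i, i) \notin E.

Definition out_neighbours E (i : 'I_n) : {set 'I_n} := [set j | (i, j) \in E].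
Definition in_neighbours E (j : 'I_n) : {set 'I_n} := [set i | (i, j) \in E].

(* [p] lists the nodes v_2, ..., v_{k+1} following the starting node v_1. *)
Definition is_path E (v1 : 'I_n) (p : seq 'I_n) : Prop :=
  [/\ p != [::], path (fun a b => (a, b) \in E) v1 p & uniq (v1 :: p)].

Definition reachable E U (j : 'I_n) : Prop :=
  j \in U \/ exists u p, [/\ u \in U, is_path E u p & last u p = j].

Definition remove_outgoing E W : {set 'I_n * 'I_n} :=
  [set e in E | e.1 \notin W].

Definition unique_reachable_in_neighbour E U (k j : 'I_n) : Prop :=
  [/\ j \in in_neighbours E k, reachable E U j
    & forall j', j' \in in_neighbours E k -> reachable E U j' -> j' = j].

Notation state := ({set 'I_n * 'I_n} * {set 'I_n})%type.

Inductive simplification_step U : state -> state -> Prop :=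
| Simplify_remove E W :
    simplification_step U (E, W) (remove_outgoing E W, W)
| Simplify_replace E W k j :
    k \in W :\: U -> unique_reachable_in_neighbour E U k j ->
    simplification_step U (E, W) (E, j |: (W :\ k)).

(* Removing outgoing edges is always permitted, so "no more changes" means
   that every permitted operation leaves the state as it is. *)
Definition final_state U (s : state) : Prop :=
  forall s', simplification_step U s s' -> s' = s.

Definition derived_set E U W (D : {set 'I_n}) : Prop :=
  exists E', clos_refl_trans _ (simplification_step U) (E, W) (E', D)
             /\ final_state U (E', D).

End Digraph.

Section NetworkMatrices.
Variables (R : realType) (n : nat).

Notation ratfun := {fraction {poly R}}.

(* [frac (repr f)] is a numerator/denominator pair, with nonzero denominator, in
   the class [f]. Neither properness nor the values at all large z depend on
   which representative is taken. *)
Definition numer (f : ratfun) : {poly R} := (frac (repr f)).1.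
Definition denom (f : ratfun) : {poly R} := (frac (repr f)).2.

Definition proper (f : ratfun) : Prop := (size (numer f) <= size (denom f))%N.

Definition ratfun_eval (f : ratfun) (z : R) : R := (numer f).[z] / (denom f).[z].

(* The limit is taken along real z; for a proper rational function with real
   coefficients it equals the limit as |z| tends to infinity in C. *)
Definition lim_infty_mx (A : 'M[ratfun]_n) : 'M[R]_n :=
  \matrix_(i, j) lim (ratfun_eval (A i j) z @[z --> +oo])%classic.

Definition principal_submx (A : 'M[R]_n) (S : {set 'I_n}) : 'M[R]_#|S| :=
  mxsub (fun k : 'I_#|S| => enum_val k) (fun k : 'I_#|S| => enum_val k) A.

(* The entry (i, j) of a network matrix carries the edge from j to i. *)
Definition admissible (E : {set 'I_n * 'I_n}) (G : 'M[ratfun]_n) : Prop :=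
  [/\ forall i j, proper (G i j),
      forall i j, G i j != 0 <-> (j, i) \in E
    & forall S : {set 'I_n},
        \det (principal_submx (lim_infty_mx (1%:M - G)) S) != 0].

Definition transfer_mx (G : 'M[ratfun]_n) : 'M[ratfun]_n := invmx (1%:M - G).

Definition selection_mx (C : {set 'I_n}) : 'M[ratfun]_(#|C|, n) :=
  \matrix_(i < #|C|, j < n) (j == enum_val i)%:R.

Definition identifiable (E : {set 'I_n * 'I_n}) (C : {set 'I_n}) : Prop :=
  forall G Gbar : 'M[ratfun]_n, admissible E G -> admissible E Gbar ->
    selection_mx C *m transfer_mx G = selection_mx C *m transfer_mx Gbar ->
    G = Gbar.

End NetworkMatrices.

Arguments identifiable R {n} E C.

(* Main.v *)
Require Import Defs.
From mathcomp Require Import all_boot all_order all_algebra.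
From mathcomp Require Import all_classical all_reals all_analysis.
From Stdlib Require Import Relation_Operators.

(** Write U for the out-neighbours of a node i. Everything rests on one linear
    system: for a network matrix G and a vector x,
      x_k = (G x)_k for every k outside U,   and   x_k = 0 for every k in C.   (1)
    Since x = T(G) v with v = (I - G) x supported on U, a nonzero solution of (1)
    is the same thing as a nonzero vector v supported on U with C T(G) v = 0.

    Identifiability is the absence of such solutions. From
    T(G) - T(H) = T(G) (G - H) T(H), two matrices with C T(G) = C T(H) satisfy
    C T(G) (G - H) = 0, and column i of G - H is supported on U; so if (1) has only
    the zero solution for every i, then G = H ([observable_identifiable]).
    Conversely, a nonzero solution x of (1) for a matrix G of constants yields
    the rank-one perturbation H = G - c v e_i^T, which has the same C-rows of T and
    is admissible for a generic constant c ([unobservable_not_identifiable]).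

    The simplification process computes with (1) by hand. If x vanishes on W, edges
    leaving W do not contribute to the equations. Nodes that U does not reach
    carry the value zero, because the corresponding principal submatrix of I - G is
    injective; so if k in W has a unique reachable in-neighbour j, the equation
    at k reads 0 = G_kj x_j, and x_k = 0 exactly when x_j = 0. Hence a
    solution of (1) vanishes on every derived set
    ([annihilated_simplification]). If that set contains U, then x vanishes on U, the
    equations say x = G x off U, and x = 0.

    If a final set W misses a node of U, a nonzero solution is built on the final
    graph ([final_state_null_solution]): there, no edge leaves W, and a node of W
    outside U has either no reachable in-neighbour or at least two, so that nonzero
    weights can make the incoming contributions cancel. This solution is carried
    back to the original graph step by step ([null_solution_simplification]). The
    weights are polynomials in a
    parameter t that vanish at t = 0, so for a generic real t all edges have nonzero
    weight and all principal minors of I - G are nonzero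
    ([regular_specialization]). *)

Set Implicit Arguments.
Unset Strict Implicit.
Unset Printing Implicit Defensive.

Import Order.TTheory GRing.Theory Num.Theory.
Import numFieldNormedType.Exports.

Local Open Scope ring_scope.

(** * Limits of rational functions at infinity *)

Section LimitAtInfinity.
Variable R : realType.
Local Notation ratfun := {fraction {poly R}}.
Local Notation tofrac := (@FracField.tofrac {poly R}).
Implicit Types (f g : ratfun) (p q : {poly R}) (a b c : R).

Lemma denom_neq0 f : denom f != 0.
Proof. exact: denom_ratioP. Qed.

Lemma ratfunE f : f = tofrac (numer f) / tofrac (denom f).
Proof.
have d0 : tofrac (denom f) != 0 by rewrite tofrac_eq0 denom_neq0.
apply: (canRL (mulfK d0)); rewrite -{1}[f]reprK !piE; apply/eqmodP => /=.
rewrite FracField.equivfE /FracField.mulf.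
by rewrite !numden_Ratio ?mulf_neq0 ?oner_neq0 ?denom_neq0 // !mulr1 mulrC.
Qed.

(** Any fraction equal to f has the same values as f wherever both denominators
    are nonzero, hence for all large z; this is how the arbitrary representative
    behind [numer] and [denom] drops out of every limit. *)
Lemma numer_denom_cross f p q : q != 0 -> f = tofrac p / tofrac q ->
  numer f * q = p * denom f.
Proof.
move=> q0 fE; apply/eqP; rewrite -tofrac_eq !rmorphM /=; apply/eqP.
have Q0 : tofrac q != 0 by rewrite tofrac_eq0.
have d0 : tofrac (denom f) != 0 by rewrite tofrac_eq0 denom_neq0.
have := etrans (esym fE) (ratfunE f); set d := tofrac (denom f) in d0 *.
by move=> /eqP; rewrite (eqr_div _ _ Q0 d0) => /eqP ->.
Qed.

Lemma cvg_inv_pinfty : (z^-1 @[z --> +oo] --> (0 : R))%classic.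
Proof.
apply/gtr0_cvgV0; last exact: cvg_id.
exact: nbhs_pinfty_gt.
Qed.

(** p(z) / z^m is the reversed polynomial \sum_i p_(m-i) X^i evaluated at 1/z. *)
Lemma cvg_horner_div_exp p m : (size p <= m.+1)%N ->
  (p.[z] / z ^+ m @[z --> +oo] --> p`_m)%classic.
Proof.
move=> szp; pose q := \poly_(i < m.+1) p`_(m - i).
have -> : p`_m = q.[0] by rewrite horner_coef0 coef_poly subn0.
apply: (@cvg_trans _ ((q.[z^-1] @[z --> +oo])%classic)); last first.
  apply: (@cvg_comp _ _ _ (fun z : R => z^-1) (horner q)).
    exact: cvg_inv_pinfty.
  exact: continuous_horner.
apply: near_eq_cvg; near=> z.
have z0 : z != 0 by rewrite gt_eqF //; near: z; exact: nbhs_pinfty_gt.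
rewrite (horner_coef_wide _ szp) horner_poly mulr_suml.
rewrite (reindex_inj rev_ord_inj) /=; apply: eq_bigr => i _.
have im : (i <= m)%N by rewrite -ltnS.
rewrite subSS subKn // exprVn -mulrA; congr (_ * _).
have <- : z ^+ (m - i) * z ^+ i = z ^+ m by rewrite -exprD subnK.
by rewrite invfM mulrCA divff ?mulr1 ?expf_neq0.
Unshelve. all: end_near. Qed.

Lemma near_pinfty_horner_neq0 p : p != 0 ->
  (\forall z \near +oo, p.[z] != 0)%classic.
Proof.
move=> p0; have szp : (size p <= (size p).-1.+1)%N by rewrite leqSpred.
have /cvgr_neq0 := cvg_horner_div_exp szp; rewrite -lead_coefE lead_coef_eq0.
move=> /(_ p0); apply: filterS => z; apply: contraNneq => ->.
by rewrite mul0r.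
Qed.

Lemma near_ratfun_evalE f p q : q != 0 -> f = tofrac p / tofrac q ->
  (\forall z \near +oo, ratfun_eval f z = p.[z] / q.[z])%classic.
Proof.
move=> q0 fE; near=> z.
have qz : q.[z] != 0 by near: z; exact: near_pinfty_horner_neq0.
have dz : (denom f).[z] != 0.
  by near: z; apply: near_pinfty_horner_neq0; exact: denom_neq0.
apply/eqP; rewrite eqr_div //; apply/eqP.
by have /(congr1 (horner^~ z)) := numer_denom_cross q0 fE; rewrite !hornerM.
Unshelve. all: end_near. Qed.

(** A relation rather than the value [lim]: stability under ring operations then
    needs no separate convergence hypothesis. *)
Definition tends_to f a := (ratfun_eval f z @[z --> +oo] --> a)%classic.

Lemma tends_to_frac f a p q : q != 0 -> f = tofrac p / tofrac q ->
  (p.[z] / q.[z] @[z --> +oo] --> a)%classic -> tends_to f a.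
Proof.
move=> q0 fE; apply: cvg_trans; apply: near_eq_cvg.
by apply: filterS (near_ratfun_evalE q0 fE) => z.
Qed.

Lemma tends_to_const c : tends_to (tofrac c%:P) c.
Proof.
apply: (@tends_to_frac _ _ c%:P 1); rewrite ?oner_neq0 ?rmorph1 ?divr1 //.
under eq_cvg do rewrite !hornerC divr1.
exact: cvg_cst.
Qed.

Lemma tends_toD f g a b : tends_to f a -> tends_to g b -> tends_to (f + g) (a + b).
Proof.
move=> fa gb.
have df : tofrac (denom f) != 0 by rewrite tofrac_eq0 denom_neq0.
have dg : tofrac (denom g) != 0 by rewrite tofrac_eq0 denom_neq0.
apply: (@tends_to_frac _ _ (numer f * denom g + numer g * denom f)
         (denom f * denom g)).
- by rewrite mulf_neq0 ?denom_neq0.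
- rewrite tofracD !tofracM -(addf_div _ _ df dg).
  by congr (_ + _); exact: ratfunE.
apply: cvg_trans (cvgD fa gb); apply: near_eq_cvg; near=> z.
rewrite /ratfun_eval hornerD !hornerM -addf_div //.
  by near: z; apply: near_pinfty_horner_neq0; exact: denom_neq0.
by near: z; apply: near_pinfty_horner_neq0; exact: denom_neq0.
Unshelve. all: end_near. Qed.

Lemma tends_toM f g a b : tends_to f a -> tends_to g b -> tends_to (f * g) (a * b).
Proof.
move=> fa gb.
apply: (@tends_to_frac _ _ (numer f * numer g) (denom f * denom g)).
- by rewrite mulf_neq0 ?denom_neq0.
- by rewrite !tofracM -mulf_div; congr (_ * _); exact: ratfunE.
apply: cvg_trans (cvgM fa gb); apply: near_eq_cvg; near=> z.
by rewrite /= /ratfun_eval !hornerM mulf_div.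
Unshelve. all: end_near. Qed.

Lemma proper_tends_to f : Defs.proper f -> exists a, tends_to f a.
Proof.
move=> pf; set m := (size (denom f)).-1.
have szd : (size (denom f) <= m.+1)%N by rewrite leqSpred.
exists ((numer f)`_m / (denom f)`_m).
have d0 : (denom f)`_m != 0 by rewrite -lead_coefE lead_coef_eq0 denom_neq0.
apply: cvg_trans (cvgM (cvg_horner_div_exp (leq_trans pf szd))
  (cvgV d0 (cvg_horner_div_exp szd))).
apply: near_eq_cvg; near=> z => /=.
have z0 : z != 0 by rewrite gt_eqF //; near: z; exact: nbhs_pinfty_gt.
by rewrite /= /ratfun_eval invf_div mulrA divfK ?expf_neq0.
Unshelve. all: end_near. Qed.

Lemma tends_to_lim f a : tends_to f a ->
  (lim (ratfun_eval f z @[z --> +oo]) = a)%classic.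
Proof. by move=> fa; apply/cvg_lim. Qed.

(** A determinant is a polynomial in the entries, so a singular matrix has a
    singular limit; this is how a condition on the limit at infinity becomes
    one on the matrix of rational functions. *)
Lemma tends_to_det m (A : 'M[ratfun]_m) (B : 'M[R]_m) :
  (forall i j, tends_to (A i j) (B i j)) -> tends_to (\det A) (\det B).
Proof.
move=> AB; rewrite /determinant.
have tends_to0 : tends_to 0 0 by have := @tends_to_const 0; rewrite polyC0 rmorph0.
have tends_to1 : tends_to 1 1 by have := @tends_to_const 1; rewrite polyC1 rmorph1.
apply: (big_ind2 tends_to) => // [f a g b|s _]; first exact: tends_toD.
apply: tends_toM.
  have := @tends_to_const ((-1) ^+ perm.odd_perm s); rewrite rmorph_sign.
  by rewrite rmorph_sign.
by apply: (big_ind2 tends_to) => // f a g b; exact: tends_toM.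
Qed.

Lemma tends_to_neq0 f a : tends_to f a -> a != 0 -> f != 0.
Proof.
move=> fa; apply: contra_neq => f0.
have := @tends_to_const 0; rewrite polyC0 rmorph0 -f0 => f00.
by rewrite -(tends_to_lim fa) -(tends_to_lim f00).
Qed.

Lemma proper_const c : Defs.proper (tofrac c%:P).
Proof.
rewrite /Defs.proper; have := @numer_denom_cross (tofrac c%:P) c%:P 1.
rewrite oner_neq0 rmorph1 divr1 mulr1 => -> //.
by rewrite mul_polyC size_scale_leq.
Qed.

End LimitAtInfinity.

(** * Network matrices and identifiability *)

Definition principal_minor1B (K : comNzRingType) n (G : 'M[K]_n) (S : {set 'I_n}) : K :=
  \det (mxsub (fun k : 'I_#|S| => enum_val k) (fun k : 'I_#|S| => enum_val k)
          (1%:M - G)).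

Lemma principal_minor1B_map (K L : comNzRingType) (f : {rmorphism K -> L}) n
    (G : 'M[K]_n) S :
  principal_minor1B (map_mx f G) S = f (principal_minor1B G S).
Proof.
by rewrite /principal_minor1B -det_map_mx map_mxsub map_mxB map_mx1.
Qed.

Lemma support_eq0 (K : nzRingType) (x : K) (b : bool) :
  (x != 0 <-> b) -> ~~ b -> x = 0.
Proof. by move=> [xb _]; apply: contraNeq. Qed.

(** The equation of (1) at node i says that the excitation (I - G) x vanishes at i. *)
Lemma residual0P (K : nzRingType) n (G : 'M[K]_n) (x : 'cV[K]_n) i :
  x i 0 = (G *m x) i 0 <-> ((1%:M - G) *m x) i 0 = 0.
Proof.
have -> : ((1%:M - G) *m x) i 0 = x i 0 - (G *m x) i 0.
  by rewrite mulmxBl mul1mx mxE; congr (_ + _); rewrite mxE.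
by split=> [->|/eqP]; rewrite ?subrr // subr_eq0 => /eqP.
Qed.

(** The restriction of x to S lies in the kernel of the principal submatrix
    of I - G on S. *)
Lemma principal_minor1B_inj (K : fieldType) n (G : 'M[K]_n) S (x : 'cV[K]_n) :
    principal_minor1B G S != 0 ->
    (forall i, i \notin S -> x i 0 = 0) ->
    (forall i, i \in S -> x i 0 = (G *m x) i 0) ->
  x = 0.
Proof.
rewrite /principal_minor1B; set A := mxsub _ _ _ => detA x0 xG.
pose y : 'cV[K]_#|S| := \col_k x (enum_val k) 0.
have Ay : A *m y = 0.
  apply/matrixP => k l; rewrite [RHS]mxE mxE.
  have /residual0P := xG _ (enum_valP k); apply: etrans.
  rewrite [RHS]mxE [RHS](bigID (mem S)) /= [X in _ = _ + X]big1 ?addr0; last first.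
    by move=> j jS; rewrite x0 ?mulr0.
  rewrite [RHS]big_enum_val /=.
  by apply: eq_bigr => j _; rewrite !mxE.
have y0 : y = 0 by rewrite -[y](mulKmx (_ : A \in unitmx)) ?Ay ?mulmx0 // unitmxE unitfE.
apply/matrixP => i j; rewrite ord1 [RHS]mxE.
have [iS|/x0//] := boolP (i \in S).
have := congr1 (fun v : 'cV_ _ => v (enum_rank_in iS i) 0) y0.
by rewrite !mxE enum_rankK_in.
Qed.

Lemma principal_minor1B_unitmx (K : fieldType) n (G : 'M[K]_n) :
  principal_minor1B G [set: 'I_n] != 0 -> 1%:M - G \in unitmx.
Proof.
move=> G0; rewrite -unitmx_tr unitmxE unitfE; apply/det0P => -[v v0 vG].
move: v0; rewrite -trmx_eq0 => /negP; apply; apply/eqP.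
apply: (principal_minor1B_inj G0) => i; rewrite inE // => _.
have /(congr1 trmx) := vG; rewrite trmx_mul trmxK trmx0 mulmxBl mul1mx.
by move/eqP; rewrite subr_eq0 => /eqP {1}->.
Qed.

Lemma principal_minor1B0 (K : comNzRingType) n (S : {set 'I_n}) :
  principal_minor1B (0 : 'M[K]_n) S = 1.
Proof.
rewrite /principal_minor1B subr0 -[RHS](det1 K #|S|); congr (\det _).
by apply/matrixP => i j; rewrite !mxE (inj_eq enum_val_inj).
Qed.

Lemma invmx_subE (K : fieldType) n (G H : 'M[K]_n) :
  1%:M - G \in unitmx -> 1%:M - H \in unitmx ->
  invmx (1%:M - G) - invmx (1%:M - H) = invmx (1%:M - G) *m (G - H) *m invmx (1%:M - H).
Proof.
move=> uG uH; rewrite (_ : G - H = (1%:M - H) - (1%:M - G)); last first.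
  by rewrite opprB [RHS]addrC addrA subrK.
rewrite mulmxBr mulVmx // mulmxBl mul1mx; congr (_ - _).
by rewrite mulmxK.
Qed.

Section Networks.
Variables (R : realType) (n : nat) (E : {set 'I_n * 'I_n}).
Local Notation ratfun := {fraction {poly R}}.
Implicit Types (C U : {set 'I_n}).

Lemma admissible_principal_minor1B (G : 'M[ratfun]_n) S :
  admissible E G -> principal_minor1B G S != 0.
Proof.
case=> Gp _ Gm; have := Gm S; apply: tends_to_neq0; apply: tends_to_det => i j.
have [b Gb] : exists b, tends_to ((1%:M - G) (enum_val i) (enum_val j)) b.
  have [a Ga] := proper_tends_to (Gp (enum_val i) (enum_val j)).
  exists ((enum_val i == enum_val j)%:R + (-1) * a); rewrite !mxE -[- G _ _]mulN1r.
  have one b : tends_to (b%:R : ratfun) (b%:R : R).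
    by have := @tends_to_const R b%:R; rewrite !rmorph_nat.
  have mone : tends_to (-1 : ratfun) (-1 : R).
    by have := @tends_to_const R (-1); rewrite !rmorphN1.
  exact: tends_toD (one _) (tends_toM mone Ga).
have -> : principal_submx (lim_infty_mx (1%:M - G)) S i j = b.
  by rewrite mxE [LHS]mxE (tends_to_lim Gb).
by rewrite mxE.
Qed.

Lemma selection_mxE C p (A : 'M[ratfun]_(n, p)) k j :
  (selection_mx R C *m A) k j = A (enum_val k) j.
Proof.
rewrite mxE (bigD1 (enum_val k)) //= mxE eqxx mul1r big1 ?addr0 // => l lk.
by rewrite mxE (negbTE lk) mul0r.
Qed.

Lemma selection_mx_eq0 C p (A : 'M[ratfun]_(n, p)) c j :
  selection_mx R C *m A = 0 -> c \in C -> A c j = 0.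
Proof.
move=> /matrixP A0 cC; have := A0 (enum_rank_in cC c) j.
by rewrite selection_mxE enum_rankK_in // mxE.
Qed.

(** Injectivity of v |-> C T(G) v on the vectors v supported on U, phrased with
    x = T(G) v so that no inverse matrix occurs. *)
Definition observable (K : comNzRingType) (G : 'M[K]_n) C U :=
  forall x : 'cV[K]_n, (forall i, i \notin U -> x i 0 = (G *m x) i 0) ->
    (forall i, i \in C -> x i 0 = 0) -> x = 0.

(** Column i of G - H is an excitation supported on the out-neighbours of i that
    cannot be seen from C. *)
Lemma observable_identifiable C :
  (forall i (G : 'M[ratfun]_n), admissible E G -> observable G C (out_neighbours E i)) ->
  identifiable R E C.
Proof.
move=> obs G H aG aH CT.
have uG := principal_minor1B_unitmx (admissible_principal_minor1B _ aG).
have [[_ GE _] [_ HE _]] := (aG, aH).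
have uH := principal_minor1B_unitmx (admissible_principal_minor1B _ aH).
have CTD : selection_mx R C *m (transfer_mx G *m (G - H)) = 0.
  have TB : transfer_mx G - transfer_mx H =
      transfer_mx G *m (G - H) *m transfer_mx H := invmx_subE uG uH.
  have CTB : selection_mx R C *m (transfer_mx G - transfer_mx H) = 0.
    by apply/eqP; rewrite mulmxBr subr_eq0; apply/eqP.
  move: CTB; rewrite TB mulmxA => /(congr1 (mulmxr (1%:M - H))) /=.
  by rewrite mul0mx (mulmxKV uH).
apply/eqP; rewrite -subr_eq0; apply/eqP/matrixP => k i.
have x0 : transfer_mx G *m col i (G - H) = 0.
  apply: (obs i G aG) => [l lU|c cC].
    have il : (i, l) \notin E by move: lU; rewrite inE.
    apply/residual0P; rewrite /transfer_mx (mulKVmx uG) !mxE.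
    by rewrite (support_eq0 (GE l i) il) (support_eq0 (HE l i) il) subr0.
  apply: etrans (selection_mx_eq0 i CTD cC).
  by rewrite [LHS]mxE [RHS]mxE; apply: eq_bigr => j _; rewrite [col _ _ _ _]mxE.
have := congr1 (mulmx (1%:M - G)) x0; rewrite (mulKVmx uG) mulmx0.
by move/(congr1 (fun B : 'cV_ _ => B k 0)); rewrite !mxE.
Qed.

(** The part of admissibility that makes sense over every ring, which allows
    passing between polynomial, real and rational-function weights. *)
Definition regular_weights (K : comNzRingType) (G : 'M[K]_n) :=
  (forall i j, G i j != 0 <-> (j, i) \in E) /\ (forall S, principal_minor1B G S != 0).

Local Notation cst := (@FracField.tofrac {poly R} \o polyC).

Lemma admissible_regular (G : 'M[ratfun]_n) : admissible E G -> regular_weights G.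
Proof.
by move=> aG; split=> [|S]; [case: aG | exact: admissible_principal_minor1B].
Qed.

Lemma regular_weights_admissible (G : 'M[R]_n) :
  regular_weights G -> admissible E (map_mx cst G).
Proof.
case=> GE Gm; split => [i j|i j|S].
- by rewrite mxE; exact: proper_const.
- by rewrite mxE tofrac_eq0 polyC_eq0; exact: GE.
have -> : lim_infty_mx (1%:M - map_mx cst G) = 1%:M - G.
  apply/matrixP => i j; rewrite [LHS]mxE; apply: tends_to_lim.
  have -> : (1%:M - map_mx cst G) i j = cst ((1%:M - G) i j).
    by rewrite -(map_mx1 cst) -map_mxB [LHS]mxE.
  exact: tends_to_const.
exact: Gm.
Qed.

Lemma transfer_mx_const (G : 'M[R]_n) :
  transfer_mx (map_mx cst G) = map_mx cst (invmx (1%:M - G)).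
Proof. by rewrite /transfer_mx map_invmx map_mxB map_mx1. Qed.

(** Finitely many nonzero polynomials have a common non-root: every edge weight
    is nonzero, and so is every principal minor, because it is nonzero at 0. *)
Lemma regular_specialization (M : 'M[{poly R}]_n) :
    (forall i j, M i j != 0 <-> (j, i) \in E) ->
    (forall S, (principal_minor1B M S).[0] != 0) ->
  exists2 t : R, t != 0 & regular_weights (map_mx (horner_eval t) M).
Proof.
move=> ME Mm.
pose q := 'X * (\prod_(e in E) M e.2 e.1) * \prod_(S : {set 'I_n}) principal_minor1B M S.
have q0 : q != 0.
  rewrite !mulf_neq0 ?polyX_eq0 //.
    by apply/prodf_neq0 => -[j i] ji /=; apply/ME.
  by apply/prodf_neq0 => S _; apply: contraNneq (Mm S) => ->; rewrite horner0.
have [t] := filter_ex (near_pinfty_horner_neq0 q0).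
rewrite !hornerM hornerX !mulf_eq0 !negb_or -andbA => /and3P[t0 tE tm].
exists t => //; split => [i j|S].
  rewrite mxE /horner_eval; split.
    by apply: contraNT => /(support_eq0 (ME i j)) ->; rewrite horner0.
  move=> ji; move: tE; rewrite horner_prod => /prodf_neq0/(_ _ ji); exact.
rewrite principal_minor1B_map /horner_eval.
by move: tm; rewrite horner_prod => /prodf_neq0; apply.
Qed.

(** With v = (I - G) x, the perturbation H = G - c v e_i^T keeps the edge set because
    v is supported on the out-neighbours of i, and
    T(G) - T(H) = c (T(G) v) (e_i^T T(H)) = c x (e_i^T T(H)) has zero rows in C. *)
Lemma unobservable_not_identifiable C i (G : 'M[R]_n) (x : 'cV[R]_n) :
    regular_weights G ->
    (forall k, k \notin out_neighbours E i -> x k 0 = (G *m x) k 0) ->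
    (forall k, k \in C -> x k 0 = 0) ->
  x != 0 -> ~ identifiable R E C.
Proof.
move=> Gr xG xC x0 idf; have [GE Gm] := Gr.
have uG := principal_minor1B_unitmx (Gm _).
pose v := (1%:M - G) *m x.
have xE : x = invmx (1%:M - G) *m v by rewrite mulKmx.
have v0 : v != 0 by apply: contra_neq x0 => v0; rewrite xE v0 mulmx0.
have vU k : (i, k) \notin E -> v k 0 = 0.
  by move=> ik; apply/residual0P/xG; rewrite inE.
(* The weights G - t v e_i^T, as polynomials in t; G itself is the value at 0. *)
pose D : 'M[R]_n := v *m delta_mx 0 i.
have DE k j : D k j = v k 0 *+ (j == i).
  by rewrite mxE big_ord1 [delta_mx _ _ _ _]mxE eqxx mulr_natr.
pose M : 'M[{poly R}]_n := map_mx polyC G - 'X *: map_mx polyC D.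
have ME k j : M k j = (G k j)%:P - 'X * (D k j)%:P.
  rewrite [LHS]mxE [X in _ + X]mxE [X in _ - X]mxE.
  by rewrite [X in X - _]mxE [X in _ - _ * X]mxE.
have Meval c k j : (M k j).[c] = G k j - c * D k j.
  by rewrite ME hornerD hornerN hornerM hornerX !hornerC.
have M0 : map_mx (horner_eval 0) M = G.
  by apply/matrixP => k j; rewrite mxE /horner_eval Meval mul0r subr0.
have Mneq0 k j : M k j != 0 <-> (j, k) \in E.
  split; rewrite ME.
    apply: contraNT => jk; rewrite (support_eq0 (GE k j) jk).
    have [ji|ji] := eqVneq j i; last first.
      by rewrite DE (negbTE ji) mulr0n polyC0 mulr0 subr0.
    by rewrite DE vU -?ji // mul0rn polyC0 mulr0 subr0.
  move/GE; apply: contra_neq => /(congr1 (horner^~ 0)).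
  by rewrite -ME Meval mul0r subr0 horner0.
have [S|c c0 Hr] := regular_specialization Mneq0.
  by rewrite -[_.[_]]/(horner_eval 0 _) -principal_minor1B_map M0.
set H := map_mx _ M in Hr.
have HE : G - H = c *: D.
  apply/matrixP => k j; rewrite [LHS]mxE [X in _ + X]mxE [X in _ - X]mxE [RHS]mxE.
  by rewrite /horner_eval Meval opprB addrC subrK.
have uH := principal_minor1B_unitmx (Hr.2 _).
have GH : G = H.
  have e : map_mx cst G = map_mx cst H.
    apply: idf (regular_weights_admissible Gr) (regular_weights_admissible Hr) _.
    rewrite !transfer_mx_const; apply/matrixP => k j.
    apply: etrans (selection_mxE _ _ _) (etrans _ (esym (selection_mxE _ _ _))).
    rewrite [LHS]mxE [RHS]mxE; congr (cst _); apply/eqP; rewrite -subr_eq0; apply/eqP.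
    have := invmx_subE uG uH; rewrite HE -scalemxAr -scalemxAl mulmxA -xE -mulmxA.
    move/matrixP/(_ (enum_val k) j); rewrite mxE [X in _ + X]mxE => ->.
    by rewrite mxE [X in _ * X]mxE big_ord1 xC ?mul0r ?mulr0 //; exact: enum_valP.
  apply/matrixP => k j; have /matrixP/(_ k j) := e.
  by rewrite [LHS]mxE [RHS]mxE => /eqP; rewrite tofrac_eq => /eqP/polyC_inj.
case/negP: v0; apply/eqP/matrixP => k l; rewrite ord1 [RHS]mxE.
have /matrixP/(_ k i) := HE; rewrite GH subrr [LHS]mxE mxE DE eqxx mulr1n.
by move/esym/eqP; rewrite mulf_eq0 (negbTE c0) => /eqP.
Qed.

End Networks.

(** * Graphs and the simplification process *)

Section Reachability.
Variable n : nat.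
Implicit Types (E : {set 'I_n * 'I_n}) (U W : {set 'I_n}).

(** Loops can be cut out of a walk, so reachability by walks, which extend freely
    by an edge, is the same notion. *)
Lemma reachableP E U j : reachable E U j <->
  exists u p, [/\ u \in U, path (fun a b => (a, b) \in E) u p & last u p = j].
Proof.
split=> [[jU|[u [p [uU [_ up _] <-]]]]|[u [p [uU up <-]]]].
- by exists j, [::].
- by exists u, p.
case/shortenP: up => q uq quniq _; case: q uq quniq => [|v q] uq quniq.
  by left.
by right; exists u, (v :: q).
Qed.

Lemma reachable_mem E U j : j \in U -> reachable E U j.
Proof. by left. Qed.

Lemma reachable_edge E U a b : reachable E U a -> (a, b) \in E -> reachable E U b.
Proof.
move=> /reachableP[u [p [uU up <-]]] ab; apply/reachableP.
by exists u, (rcons p b); rewrite rcons_path up ab last_rcons.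
Qed.

Lemma reachable_subset E E' U j : E' \subset E -> reachable E' U j -> reachable E U j.
Proof.
move=> /fintype.subsetP E'E /reachableP[u [p [uU up <-]]]; apply/reachableP.
exists u, p; split=> //; apply: sub_path up => a b; exact: E'E.
Qed.

(** The distance from U decreases along the last edge of a shortest walk. *)
Lemma reachable_rank E U : exists d : 'I_n -> nat, forall j,
  reachable E U j -> j \notin U ->
  exists i, [/\ reachable E U i, (i, j) \in E & (d i < d j)%N].
Proof.
pose walk j m := `[< exists u p, [/\ u \in U, path (fun a b => (a, b) \in E) u p,
   last u p = j & size p = m] >].
have /choice[d dP] : forall j, exists m, reachable E U j ->
    walk j m /\ forall m', walk j m' -> (m <= m')%N.
  move=> j; have [jr|] := pselect (reachable E U j); last by exists 0%N.
  have ex : exists m, walk j m.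
    have /reachableP[u [p [uU up pj]]] := jr.
    by exists (size p); apply/asboolP; exists u, p.
  by case: (ex_minnP ex) => m jm mmin; exists m.
exists d => j jr jU; have [/asboolP[u [p [uU up pj <-]]] _] := dP j jr.
case: (lastP p) up pj => [_ /= uj|q k]; first by rewrite -uj uU in jU.
rewrite rcons_path last_rcons size_rcons => /andP[uq ek] kj; subst k.
have ir : reachable E U (last u q) by apply/reachableP; exists u, q.
exists (last u q); split=> //; rewrite ltnS; apply: (dP _ ir).2.
by apply/asboolP; exists u, q.
Qed.

Lemma final_state_no_outgoing E U W a b :
  final_state U (E, W) -> (a, b) \in E -> a \notin W.
Proof.
move=> fin ab; have [EE] := fin _ (Simplify_remove U E W).
by move: ab; rewrite -[in X in X -> _]EE inE => /andP[].
Qed.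

(** With a single reachable in-neighbour i of k, replacing k by i would still be
    possible, and would change W because i and k differ. *)
Lemma final_state_two_in_neighbours E U W i k :
    (forall a, (a, a) \notin E) -> final_state U (E, W) ->
    k \in W -> k \notin U -> (i, k) \in E -> reachable E U i ->
  exists2 j, j != i & (j, k) \in E /\ reachable E U j.
Proof.
move=> loop fin kW kU ik ir; apply: contrapT => none.
have kWU : k \in W :\: U by rewrite inE kU.
have uniq : unique_reachable_in_neighbour E U k i.
  split=> [|//|j]; rewrite inE // => jk jr.
  by apply/eqP; apply: contrapT => /negP ji; apply: none; exists j.
have [] := fin _ (Simplify_replace kWU uniq).
move=> /setP/(_ k); rewrite kW !inE eqxx orbF => /eqP ki.
by have := loop k; rewrite {1}ki ik.
Qed.

Lemma simplification_subset U s s' :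
  clos_refl_trans _ (simplification_step U) s s' -> s'.1 \subset s.1.
Proof.
elim=> {s s'} [s s'|s|s1 s2 s3 _ h1 _ h2] //; last exact: fintype.subset_trans h2 h1.
by case=> // E W /=; apply/fintype.subsetP => e; rewrite inE => /andP[].
Qed.

End Reachability.

Section Invariants.
Variables (n : nat) (E0 : {set 'I_n * 'I_n}) (U : {set 'I_n}).
Local Notation state := ({set 'I_n * 'I_n} * {set 'I_n})%type.
Implicit Types (E : {set 'I_n * 'I_n}) (W : {set 'I_n}) (s : state).

(** Along a simplification, x vanishes on the current W and at the tail of every
    deleted edge, so that deleted edges do not affect the equations of (1). *)
Definition annihilated (K : nzRingType) (x : 'cV[K]_n) s :=
  (forall i, i \in s.2 -> x i 0 = 0) /\
  (forall a b, (a, b) \in E0 -> x a 0 != 0 -> (a, b) \in s.1).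

Lemma annihilated_step (K : fieldType) (G : 'M[K]_n) (x : 'cV[K]_n) s s' :
    regular_weights E0 G -> s.1 \subset E0 ->
    (forall i, i \notin U -> x i 0 = (G *m x) i 0) ->
  simplification_step U s s' -> annihilated x s -> annihilated x s'.
Proof.
move=> [GE Gm] sE0 xG st; case: st sE0 => {s s'} [E W|E W k j] /=.
  move=> _ [xW xE]; split=> // a b ab xa; rewrite inE xE //=.
  by apply: contraNN xa => /xW ->.
rewrite inE => /andP[kU kW] [jk jr juniq] sE0 [xW xE]; split=> // i.
rewrite !inE => /orP[/eqP ->|/andP[_ /xW //]].
(* On the unreachable nodes, x solves a homogeneous system of its own: an edge
   into Z from a node where x is nonzero survives, so it starts in Z. *)
pose Z := [set i | ~~ `[< reachable E U i >]].
pose y : 'cV[K]_n := \col_i (if i \in Z then x i 0 else 0).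
have yE i' : y i' 0 = if i' \in Z then x i' 0 else 0 by rewrite mxE.
have y0 : y = 0.
  apply: (principal_minor1B_inj (Gm Z)) => [i' /negbTE iZ|i' iZ]; first by rewrite yE iZ.
  have ir : ~ reachable E U i' by move: iZ; rewrite inE => /asboolPn.
  rewrite yE iZ xG; last by apply/negP => /(reachable_mem E).
  rewrite [LHS]mxE [RHS]mxE; apply: eq_bigr => l _; rewrite yE.
  case: ifPn => //; rewrite inE negbK => /asboolP lr.
  have [G0|] := eqVneq (G i' l) 0; first by rewrite G0 !mul0r.
  move=> /GE li; have [->|/(xE _ _ li) lE] := eqVneq (x l 0) 0; first by rewrite !mulr0.
  by case: ir; exact: reachable_edge lr lE.
have x0 l : ~ reachable E U l -> x l 0 = 0.
  move=> lr; have /matrixP/(_ l 0) := y0; rewrite yE mxE.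
  by rewrite inE ifT //; apply/asboolPn.
have : G k j * x j 0 = 0.
  have := xG k kU; rewrite (xW _ kW) mxE (bigD1 j) //= big1 ?addr0 // => l lj.
  have [G0|] := eqVneq (G k l) 0; first by rewrite G0 mul0r.
  move=> /GE lk; have [->|xl] := eqVneq (x l 0) 0; first by rewrite mulr0.
  have lE := xE _ _ lk xl; rewrite x0 ?mulr0 // => lr.
  by case/eqP: lj; apply: juniq => //; rewrite inE.
move/eqP; rewrite mulf_eq0 => /orP[|/eqP//] G0.
have /GE : (j, k) \in E0 by apply: (fintype.subsetP sE0); rewrite inE in jk.
by rewrite G0.
Qed.

Lemma annihilated_simplification (K : fieldType) (G : 'M[K]_n) (x : 'cV[K]_n) s s' :
    regular_weights E0 G ->
    (forall i, i \notin U -> x i 0 = (G *m x) i 0) ->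
    clos_refl_trans _ (simplification_step U) s s' ->
  s.1 \subset E0 -> annihilated x s -> annihilated x s'.
Proof.
move=> Gr xG; elim=> {s s'} [s s' st sE|//|s1 s2 s3 st1 h1 _ h2 sE x1].
  exact: annihilated_step Gr sE xG st.
apply: (h2 _ (h1 sE x1)); apply: fintype.subset_trans sE.
exact: simplification_subset st1.
Qed.

(** The system (1) of the current graph. The last condition stands in for the
    regularity of the weights restricted to the current graph: it is inherited by
    larger graphs, as deleting edges only shrinks the reachable set. *)
Definition null_solution (K : nzRingType) (G : 'M[K]_n) (x : 'cV[K]_n) s :=
  [/\ forall i, i \notin U -> x i 0 = \sum_(j | (j, i) \in s.1) G i j * x j 0,
      forall i, i \in s.2 -> x i 0 = 0
    & forall i, x i 0 != 0 -> reachable s.1 U i].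

(** Undoing a deletion adds terms in which x vanishes; undoing a replacement of k
    by j needs x_k = 0, and all terms of the equation at k vanish: that of j because
    j lies in the new W, the others because their nodes are not reachable. *)
Lemma null_solution_step (K : nzRingType) (G : 'M[K]_n) (x : 'cV[K]_n) s s' :
  simplification_step U s s' -> null_solution G x s' -> null_solution G x s.
Proof.
case=> {s s'} [E W|E W k j] /=.
  move=> [xG xW xr]; split=> //=; last first.
    move=> i /xr; apply: reachable_subset; apply/fintype.subsetP => e.
    by rewrite inE => /andP[].
  move=> i iU; rewrite xG //= [RHS](bigID (mem W)) /= [X in _ = X + _]big1 ?add0r.
    by apply: eq_bigl => l; rewrite inE.
  by move=> l /andP[_ lW]; rewrite xW ?mulr0.
rewrite inE => /andP[kU kW] [jk jr juniq] [xG xW xr]; split=> //= i iW.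
have [->|ik] := eqVneq i k; last by rewrite xW // !inE ik iW orbT.
rewrite xG //= big1 // => l lk; have [->|/xr lr] := eqVneq (x l 0) 0; first by rewrite mulr0.
have -> : l = j by apply: juniq => //; rewrite inE.
by rewrite xW ?mulr0 // !inE eqxx.
Qed.

Lemma null_solution_simplification (K : nzRingType) (G : 'M[K]_n) (x : 'cV[K]_n) s s' :
  clos_refl_trans _ (simplification_step U) s s' ->
  null_solution G x s' -> null_solution G x s.
Proof.
by elim=> {s s'} [s s' /null_solution_step|//|s1 s2 s3 _ h1 _ h2 /h2/h1]; apply.
Qed.

End Invariants.

(** The solution is x_j = t^(d j) on the reachable nodes outside W, with d
    as in [reachable_rank]. At a reachable node i outside U, one in-neighbour
    [par i], closer to U, is singled out: each other reachable one contributes t^D,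
    and the weight from [par i] makes the total equal to x_i. This weight is nonzero:
    off W because D > d i, and on W because there is another reachable in-neighbour
    and the characteristic is 0. *)
Lemma final_state_null_solution (R : numDomainType) n (E0 E : {set 'I_n * 'I_n})
    (U W : {set 'I_n}) u :
    E \subset E0 -> (forall a, (a, a) \notin E) -> final_state U (E, W) ->
    u \in U -> u \notin W ->
  exists (M : 'M[{poly R}]_n) (x : 'cV[{poly R}]_n),
    [/\ forall i j, M i j != 0 <-> (j, i) \in E0,
        forall i j, (M i j).[0] = 0,
        null_solution U M x (E, W)
      & exists m, x u 0 = 'X^m].
Proof.
move=> /fintype.subsetP EE0 loop fin uU uW.
have [d dP] := reachable_rank E U.
have /choice[par parP] : forall i, exists j, reachable E U i -> i \notin U ->
    [/\ reachable E U j, (j, i) \in E & (d j < d i)%N].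
  move=> i; have [ir|] := pselect (reachable E U i); last by exists i.
  have [|iU] := boolP (i \in U); first by exists i.
  by have [j jP] := dP i ir iU; exists j.
pose D := (\max_i d i).+1.
have dD i : (d i < D)%N by rewrite ltnS; exact: (leq_bigmax i).
pose act i j := [&& (j, i) \in E, `[< reachable E U j >] & i \notin U].
pose m i := #|[set j | act i j & j != par i]|.
(* The term - m t^D of par i cancels the contributions t^D of the m others. *)
pose c i j : {poly R} := if j == par i
  then (if i \in W then 0 else 'X^(d i - d j)) - 'X^(D - d j) *+ m i
  else 'X^(D - d j).
(* The remaining edges carry no contribution of x, enter U, or have been deleted;
   their weight t is arbitrary. *)
pose M : 'M[{poly R}]_n := \matrix_(i, j)
  if (j, i) \notin E0 then 0 else if act i j then c i j else 'X.
pose x : 'cV[{poly R}]_n := \col_j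
  if `[< reachable E U j >] && (j \notin W) then 'X^(d j) else 0.
have actP i j : act i j -> [/\ (j, i) \in E, reachable E U j, i \notin U,
   reachable E U i & j \notin W].
  case/and3P => ji /asboolP jr iU; split=> //; first exact: reachable_edge jr ji.
  exact: final_state_no_outgoing fin ji.
have ME i j : M i j = if (j, i) \notin E0 then 0 else if act i j then c i j else 'X.
  by rewrite mxE.
have xE j : x j 0 = if `[< reachable E U j >] && (j \notin W) then 'X^(d j) else 0.
  by rewrite mxE.
have c0 i j : act i j -> c i j != 0.
  move=> aij; have [ji jr iU ir jW] := actP _ _ aij; rewrite /c.
  case: (eqVneq j (par i)) => [jp|_]; last by rewrite -size_poly_gt0 size_polyXn.
  have [_ pi dp] := parP i ir iU; rewrite -jp in pi dp.
  case: ifPn => iW.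
    rewrite sub0r oppr_eq0 -mulr_natl mulf_neq0 -?size_poly_gt0 ?size_polyXn //.
    rewrite size_poly_gt0 -polyC_natr polyC_eq0 pnatr_eq0 -lt0n; apply/card_gt0P.
    have [l lj [li lr]] := final_state_two_in_neighbours loop fin iW iU ji jr.
    by exists l; rewrite inE -jp lj andbT /act li iU andbT; apply/asboolP.
  (* The two powers of t differ, so that t^(d i - d j) has coefficient 1. *)
  apply: contraTneq (oner_neq0 R) => /(congr1 (fun p : {poly R} => p`_(d i - d j))).
  rewrite coefB coefMn !coefXn coef0 eqxx (_ : _ == _ = false) ?mul0rn ?subr0.
    by rewrite mulr1n => ->; rewrite eqxx.
  by apply/negbTE; rewrite ltn_eqF // ltn_sub2r.
exists M, x; split.
- move=> i j; rewrite ME; case: (boolP ((j, i) \in E0)) => ji /=; last by rewrite eqxx.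
  by case: ifPn => [/c0|_] //; rewrite polyX_eq0.
- move=> i j; rewrite ME; case: ifPn; rewrite ?horner0 // => _.
  case: ifPn => [aij|_]; last by rewrite hornerX.
  have [_ _ iU ir _] := actP _ _ aij.
  have Xpos k : (0 < k)%N -> ('X^k : {poly R}).[0] = 0.
    by move=> k0; rewrite hornerXn expr0n gtn_eqF.
  rewrite /c; case: (eqVneq j (par i)) => [jp|_]; last by rewrite Xpos // subn_gt0.
  have [_ _ dp] := parP i ir iU; rewrite -jp in dp.
  rewrite hornerD hornerN hornerMn Xpos ?subn_gt0 // mul0rn subr0.
  by case: ifP => _; rewrite ?horner0 // Xpos // subn_gt0.
- split=> /= [i iU|i iW|i]; last 2 first.
  + by rewrite xE iW andbF.
  + by rewrite xE; case: asboolP => //=; rewrite eqxx.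
  rewrite xE; case: asboolP => /= [ir|ir]; last first.
    rewrite big1 // => j ji; rewrite xE asboolF ?mulr0 //.
    by move=> /reachable_edge/(_ ji).
  have [pr pi dp] := parP i ir iU.
  have ap : act i (par i) by rewrite /act pi iU andbT; apply/asboolP.
  transitivity (\sum_(j | act i j) c i j * 'X^(d j)).
    rewrite (bigD1 (par i)) //= {1}/c eqxx mulrBl mulrnAl -exprD subnK; last exact: ltnW.
    rewrite (eq_bigr (fun=> 'X^D)); last first.
      by move=> j /andP[_ /negbTE jp]; rewrite /c jp -exprD subnK // ltnW.
    rewrite sumr_const -addrA [- _ + _](_ : _ = 0) ?addr0.
      by case: (i \in W); rewrite ?mul0r //= -exprD subnK // ltnW.
    by rewrite addrC /m cardsE subrr.
  rewrite [RHS](bigID (act i)) /= [X in _ = _ + X]big1 ?addr0.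
    apply: eq_big => [j|j aij]; first by rewrite /act; case: ((j, i) \in E).
    have [ji jr _ _ jW] := actP _ _ aij.
    by rewrite ME (EE0 _ ji) aij xE jW asboolT.
  move=> j /andP[ji]; rewrite /act ji iU andbT /= => /negbTE jr.
  by rewrite xE jr mulr0.
exists (d u); rewrite xE uW asboolT //; exact: reachable_mem.
Qed.

(** * The characterization *)

Theorem theorem3 (R : realType) (n : nat) (E : {set 'I_n * 'I_n})
    (C : {set 'I_n}) (D : 'I_n -> {set 'I_n}) :
  simple_digraph E ->
  (forall i : 'I_n, derived_set E (out_neighbours E i) C (D i)) ->
  (identifiable R E C <-> forall i : 'I_n, out_neighbours E i \subset D i).
Proof.
move=> loop derD; split=> [idf i|UD].
  apply/fintype.subsetP => u uU; apply: contrapT => /negP uD.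
  have [E' [steps fin]] := derD i.
  have E'E : E' \subset E := simplification_subset steps.
  have loop' a : (a, a) \notin E' by apply: contra (loop a); exact: fintype.subsetP.
  have [M [x [ME M0 xsol [m xu]]]] :=
    final_state_null_solution R E'E loop' fin uU uD.
  have [xM xC _] := null_solution_simplification steps xsol.
  have [S|t t0 Gr] := regular_specialization ME.
    rewrite -[_.[_]]/(horner_eval 0 _) -principal_minor1B_map.
    (* At t = 0 the weights vanish, and every principal minor of I is 1. *)
    rewrite (_ : map_mx _ M = 0) ?principal_minor1B0 ?oner_neq0 //.
    by apply/matrixP => k j; rewrite mxE [RHS]mxE; exact: M0.
  apply: (unobservable_not_identifiable (i := i) (x := map_mx (horner_eval t) x)
    Gr _ _ _ idf).
  - move=> k kU; rewrite mxE xM // (raddf_sum (horner_eval t)) mxE big_mkcond /=.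
    apply: eq_bigr => j _; rewrite !mxE; case: ifPn => [_|jk].
      by rewrite /horner_eval hornerM.
    by rewrite (support_eq0 (ME k j) jk) /horner_eval horner0 mul0r.
  - by move=> k kC; rewrite mxE xC // /horner_eval horner0.
  apply: contra_neq (expf_neq0 m t0) => /matrixP/(_ u 0).
  by rewrite [LHS]mxE [RHS]mxE xu /horner_eval hornerXn.
apply: observable_identifiable => i G aG x xG xC.
have Gr := admissible_regular aG.
have [E' [steps _]] := derD i.
have [xD _] := annihilated_simplification Gr xG steps (subxx _) (conj xC (fun _ _ h _ => h)).
(* Now x vanishes on U and satisfies x = G x elsewhere. *)
apply: (principal_minor1B_inj (Gr.2 (~: out_neighbours E i))) => k.
  by rewrite inE negbK => kU; apply: xD; exact: (fintype.subsetP (UD i)).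
by rewrite inE; exact: xG.
Qed.
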